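(* Let $G$ be a graph with vertex set $V(G)=\{v_1,v_2,\ldots,v_n\}$. Then, for any $\alpha\in(0,1]$, $$\det(B_\alpha(G))=\sum_{H}(-1)^{n-p(H)}\,2^{c(H)}\,(1-\alpha)^{c_2(H)}\,(2\alpha-1)^{n-c_2(H)}\left(\prod_{v_i\in\mathcal{C}_2(H)}d_G(v_i)\right),$$ where the summation is over all spanning modified elementary subgraphs $H$ of $G$.
   Context: All graphs are simple and undirected, with a finite vertex set. $A(G)$ is the adjacency matrix, $D(G)$ the diagonal matrix of vertex degrees, and $L(G)=D(G)-A(G)$ the Laplacian matrix of $G$. For $\alpha\in[0,1]$, $B_\alpha(G):=\alpha A(G)+(1-\alpha)L(G)$. $d_G(v)$ is the degree of $v$ in $G$. A subgraph $H$ of $G$ is a modified elementary subgraph if each component of $H$ is either a single vertex, a single edge (with its two ends), or a cycle; it is spanning if its vertex set is $V(G)$. For such $H$: $c(H)$, $c_1(H)$, $c_2(H)$ are the numbers of components of $H$ that are cycles, edges, and vertices respectively; $p(H):=c(H)+c_1(H)+c_2(H)$ is the number of components; $\mathcal{C}_2(H)$ is the set of isolated vertices of $H$. Conventions: $0^0=1$ and empty products equal $1$. *)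

(* Defs.v *)
From mathcomp Require Import all_boot all_order all_algebra.

Set Implicit Arguments.
Unset Strict Implicit.
Unset Printing Implicit Defensive.

Import Order.TTheory GRing.Theory Num.Theory.

Record sgraph (T : finType) := SGraph {
  adj : rel T;
  adj_sym : symmetric adj;
  adj_irr : irreflexive adj
}.

Section Graphs.

Variable T : finType.
Implicit Types (G : sgraph T) (H C : {set T} * {set {set T}}).

Definition deg G (v : T) : nat := #|[set u | adj G v u]|.

Definition edges G : {set {set T}} :=
  [set e : {set T} | [exists x, exists y, adj G x y && (e == [set x; y])]].

(* A candidate subgraph is a pair (vertex set, edge set), so that two subgraphs
   are equal exactly when both sets agree. *)
Definition vset H : {set T} := H.1.
Definition eset H : {set {set T}} := H.2.

Definition subgraph G H : bool :=
  (eset H \subset edges G) && [forall e in eset H, e \subset vset H].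

Definition spanning H : bool := vset H == [set: T].

Definition hadj H : rel T := fun x y => [set x; y] \in eset H.

Definition component H (x : T) : {set T} * {set {set T}} :=
  let V := [set y in vset H | connect (hadj H) x y] in
  (V, [set e in eset H | e \subset V]).

Definition components H : {set {set T} * {set {set T}}} :=
  [set component H x | x in vset H].

Definition is_vertex C : bool := [exists x, C == ([set x], set0)].

Definition is_edge C : bool :=
  [exists x, exists y, (x != y) && (C == ([set x; y], [set [set x; y]]))].

(* The vertices of a cycle are listed without repetition, so bounding the
   length k by #|T| loses nothing; it makes the existential decidable. *)
Definition is_cycle C : bool :=
  [exists k : 'I_#|T|.+1, exists s : k.-tuple T,
    [&& 2 < k, uniq s
      & C == ([set x in s], [set [set x; next s x] | x in s])]].

Definition modified_elementary H : bool :=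
  [forall C in components H, [|| is_vertex C, is_edge C | is_cycle C]].

Definition num_cycles H : nat := #|[set C in components H | is_cycle C]|.
Definition num_edges H : nat := #|[set C in components H | is_edge C]|.
Definition num_vertices H : nat := #|[set C in components H | is_vertex C]|.
Definition num_components H : nat :=
  num_cycles H + num_edges H + num_vertices H.

Definition isolated H : {set T} :=
  [set x in vset H | [forall y, ~~ hadj H x y]].

Definition spanning_modified_elementary G H : bool :=
  [&& subgraph G H, spanning H & modified_elementary H].

End Graphs.

Section Matrices.

Local Open Scope ring_scope.

Variables (R : pzRingType) (n : nat).
Implicit Type G : sgraph 'I_n.

Definition adjacency_mx G : 'M[R]_n := \matrix_(i, j) (adj G i j)%:R.

Definition degree_mx G : 'M[R]_n := diag_mx (\row_i (deg G i)%:R).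

Definition laplacian_mx G : 'M[R]_n := degree_mx G - adjacency_mx G.

Definition B_mx (alpha : R) G : 'M[R]_n :=
  alpha *: adjacency_mx G + (1 - alpha) *: laplacian_mx G.

End Matrices.

(* Main.v *)
Require Import Defs.
From mathcomp Require Import all_boot all_order all_algebra fingroup perm.

Set Implicit Arguments.
Unset Strict Implicit.
Unset Printing Implicit Defensive.

Import Order.TTheory GRing.Theory Num.Theory.

(** The diagonal of the matrix is (1 - alpha) deg(v), and the entry at two
    distinct vertices is 2 alpha - 1 or 0 according to whether they are
    adjacent.  In the Leibniz expansion of the determinant, the permutation s
    therefore contributes nothing unless every vertex v that it moves is
    adjacent to s v.  Joining each moved v to s v then gives a spanning subgraph
    [cycle_graph s] of G, whose components are the cycles of s: a fixed point is
    a single vertex, a transposition an edge, and a longer cycle of s a cycle.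
    The terms of the expansion are grouped by the value H of [cycle_graph s].

    All the permutations with the same H have the same term
    ([odd_perm_cycle_graph], [prod_B_mx]): the sign is that of n minus the
    number of cycles of s, that is, of components of H; the fixed points of s
    are the isolated vertices of H, each bringing (1 - alpha) deg(v), and each
    of the other vertices brings 2 alpha - 1.

    It remains to count these permutations.  One exists as soon as H is
    spanning modified elementary: turn each component cyclically
    ([ex_cycle_graph]).  Any other agrees on each component either with the
    first one or with its inverse, since once it has taken one step along a
    cycle it must continue in that direction ([same_direction_fconnect]).  The
    choices are independent, and the two differ exactly on the components that
    are cycles, so there are 2 ^ c(H) permutations
    ([card_cycle_graph_fiber]). *)

(** * Edges as doubletons, and components *)

Section Doubletons.
Variable T : finType.
Implicit Types x y a b : T.

Lemma eq_set2P x y a b :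
  reflect (x = a /\ y = b \/ x = b /\ y = a) ([set x; y] == [set a; b]).
Proof.
apply: (iffP eqP) => [E|[[-> ->] //|[-> ->]]]; last exact: setUC.
have /set2P xab: x \in [set a; b] by rewrite -E set21.
have /set2P yab: y \in [set a; b] by rewrite -E set22.
have /set2P axy: a \in [set x; y] by rewrite E set21.
have /set2P bxy: b \in [set x; y] by rewrite E set22.
by case: xab yab axy bxy => [] ? [] ? [] ? [] ?; subst; auto.
Qed.

Lemma mem_edges (G : sgraph T) x y : ([set x; y] \in edges G) = adj G x y.
Proof.
rewrite inE; apply/existsP/idP => [[a /existsP[b /andP[Gab]]]|Gxy].
  by case/eq_set2P=> [[-> ->]|[-> ->]] //; rewrite adj_sym.
by exists x; apply/existsP; exists y; rewrite Gxy eqxx.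
Qed.

Lemma connect_hadj_sym (H : {set T} * {set {set T}}) : connect_sym (hadj H).
Proof. by apply: sym_connect_sym => x y; rewrite /hadj setUC. Qed.

Lemma component_connect (H : {set T} * {set {set T}}) x y :
  connect (hadj H) x y -> component H x = component H y.
Proof.
move=> xy; rewrite /component.
suff -> : [set z in vset H | connect (hadj H) x z]
        = [set z in vset H | connect (hadj H) y z] by [].
by apply/setP=> z; rewrite !inE (same_connect (@connect_hadj_sym H) xy).
Qed.

End Doubletons.

(** * Vertices, edges and cycles as cyclic sequences *)

Section Circuits.
Variable T : finType.
Implicit Types (q : seq T) (x y : T) (C : {set T} * {set {set T}}).

(** Dropping the loops [next q x = x] lets a sequence of length 1, 2 or more
    describe a single vertex, a single edge or a cycle, so that the three kinds
    of components can be handled at once. *)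
Definition circuit q : {set T} * {set {set T}} :=
  ([set x in q], [set [set x; next q x] | x in q & next q x != x]).

Lemma next_neq q x : uniq q -> x \in q -> 1 < size q -> next q x != x.
Proof.
move=> Uq /rot_to[i p Ep]; rewrite -(next_rot i Uq) -(size_rot i).
move: Uq; rewrite -(rot_uniq i) Ep.
case: p {Ep} => //= y p /andP[].
by rewrite inE negb_or eqxx => /andP[]; rewrite eq_sym.
Qed.

Lemma card_circuit q : uniq q -> #|(circuit q).1| = size q.
Proof. by move=> Uq; rewrite cardsE; apply/card_uniqP. Qed.

Lemma circuit_long q : uniq q -> 1 < size q ->
  circuit q = ([set x in q], [set [set x; next q x] | x in q]).
Proof.
move=> Uq q1; congr pair; apply/setP=> e; apply/imsetP/imsetP=> [] [x].
  by rewrite inE => /andP[qx _] ->; exists x.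
by move=> qx ->; exists x; rewrite // inE qx next_neq.
Qed.

Lemma circuit1 x : circuit [:: x] = ([set x], set0).
Proof.
congr pair; first by apply/setP=> y; rewrite !inE.
apply/eqP; rewrite imset_eq0; apply/eqP/setP => y; rewrite !inE /= eq_sym.
by case: eqP => //= <-; rewrite eqxx.
Qed.

Lemma circuit2 x y : x != y ->
  circuit [:: x; y] = ([set x; y], [set [set x; y]]).
Proof.
move=> xy; rewrite circuit_long //= ?inE ?xy //; congr pair.
  by apply/setP=> z; rewrite !inE.
apply/setP=> e; rewrite inE; apply/imsetP/eqP => [[z]|->].
  rewrite !inE => /orP[]/eqP-> -> /=; rewrite eqxx // ?(negPf xy).
  by rewrite 1?eq_sym ?(negPf xy) ?eqxx 1?setUC.
by exists x; rewrite ?inE ?eqxx //=.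
Qed.

Lemma is_vertex_card C : is_vertex C -> #|C.1| = 1.
Proof. by case/existsP=> x /eqP->; rewrite cards1. Qed.

Lemma is_edge_card C : is_edge C -> #|C.1| = 2.
Proof.
by case/existsP=> x /existsP[y /andP[xy /eqP->]]; rewrite cards2 xy.
Qed.

Lemma is_cycle_card C : is_cycle C -> 2 < #|C.1|.
Proof.
case/existsP=> k /existsP[q /and3P[k2 Uq /eqP->]].
by rewrite cardsE (card_uniqP Uq) size_tuple.
Qed.

Lemma is_vertex_circuit q : uniq q -> is_vertex (circuit q) = (size q == 1).
Proof.
move=> Uq; apply/idP/idP => [/is_vertex_card|].
  by rewrite card_circuit // => ->.
case: q Uq => [|x [|]] // _ _; apply/existsP; exists x; exact/eqP/circuit1.
Qed.

Lemma is_edge_circuit q : uniq q -> is_edge (circuit q) = (size q == 2).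
Proof.
move=> Uq; apply/idP/idP => [/is_edge_card|].
  by rewrite card_circuit // => ->.
case: q Uq => [|x [|y [|]]] //=; rewrite inE andbT => xy _.
by apply/existsP; exists x; apply/existsP; exists y; rewrite xy circuit2 ?eqxx.
Qed.

Lemma is_cycle_circuit q : uniq q -> is_cycle (circuit q) = (2 < size q).
Proof.
move=> Uq; apply/idP/idP => [/is_cycle_card|q2]; first by rewrite card_circuit.
have leq : size q < #|T|.+1 by rewrite ltnS -(card_uniqP Uq) max_card.
apply/existsP; exists (Ordinal leq); apply/existsP; exists (in_tuple q).
by rewrite q2 Uq circuit_long //= ltnW.
Qed.

(** Together with the three characterizations by length above, this makes the
    modified elementary graphs those whose components are circuits. *)
Lemma elementary_circuit C : [|| is_vertex C, is_edge C | is_cycle C] ->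
  exists2 q, uniq q & C = circuit q.
Proof.
case/or3P.
- by case/existsP=> x /eqP->; exists [:: x] => //; rewrite circuit1.
- case/existsP=> x /existsP[y /andP[xy /eqP->]].
  by exists [:: x; y]; rewrite /= ?inE ?xy ?circuit2.
case/existsP=> k /existsP[q /and3P[k2 Uq /eqP->]].
by exists q => //; rewrite circuit_long // size_tuple ltnW.
Qed.

End Circuits.

(** * The graph formed by the cycles of a permutation *)

Section CycleGraph.
Variable T : finType.
Implicit Types (s t : {perm T}) (x y : T) (H : {set T} * {set {set T}}).

Definition cycle_graph s : {set T} * {set {set T}} :=
  (setT, [set [set x; s x] | x in T & s x != x]).

Lemma hadj_cycle_graphP s x y :
  reflect (x != y /\ (y = s x \/ x = s y)) (hadj (cycle_graph s) x y).
Proof.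
apply: (iffP imsetP) => [[z]|[xy [E|E]]].
- by rewrite inE /= => sz /eqP/eq_set2P[][-> ->];
    rewrite ?sz 1?eq_sym ?sz; auto.
- by exists x; rewrite ?E // inE /= -E eq_sym.
- by exists y; rewrite ?[x]E 1?setUC // inE /= -E.
Qed.

Lemma hadj_cycle_graph s x : hadj (cycle_graph s) x (s x) = (s x != x).
Proof. by rewrite eq_sym; apply/hadj_cycle_graphP/idP => [[]|]; auto. Qed.

Lemma connect_cycle_graph s x y :
  connect (hadj (cycle_graph s)) x y = fconnect s x y.
Proof.
have sI: injective s := @perm_inj _ s.
apply/idP/idP; apply: connect_sub => {x y} x y.
  case/hadj_cycle_graphP=> _ [->|->]; first exact: fconnect1.
  by rewrite fconnect_sym // fconnect1.
move/eqP<-; have [->|ne] := eqVneq (s x) x; first exact: connect0.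
by apply: connect1; rewrite hadj_cycle_graph.
Qed.

(** On an orbit listed in the order of iteration, [next] is [s] itself. *)
Lemma component_cycle_graph s x :
  component (cycle_graph s) x = circuit (orbit s x).
Proof.
have nextE z : z \in orbit s x -> next (orbit s x) z = s z.
  by move=> /(next_cycle (cycle_orbit (@perm_inj _ s) x))/eqP.
have VE : [set y in setT | connect (hadj (cycle_graph s)) x y]
          = [set y in orbit s x].
  by apply/setP=> y; rewrite !inE connect_cycle_graph fconnect_orbit.
rewrite /component /vset /= VE; congr pair; apply/setP=> e; rewrite inE.
apply/andP/imsetP => [[/imsetP[z]]|[z]]; rewrite inE /= => sz.
  move=> -> /subsetP/(_ z (set21 _ _)); rewrite inE => oz.
  by exists z; rewrite ?inE ?oz ?nextE.
case/andP: sz => oz; rewrite nextE // => sz ->; split.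
  by apply/imsetP; exists z; rewrite ?inE.
by apply/subsetP => y /set2P[]->; rewrite inE ?mem_orbit.
Qed.

Lemma component_cycle_graph_eq s x y :
  (component (cycle_graph s) x == component (cycle_graph s) y) = fconnect s x y.
Proof.
apply/eqP/idP => [|xy]; last first.
  by apply: component_connect; rewrite connect_cycle_graph.
rewrite !component_cycle_graph => -[/setP/(_ y)].
by rewrite !inE -!fconnect_orbit connect0.
Qed.

Lemma modified_elementary_cycle_graph s : modified_elementary (cycle_graph s).
Proof.
apply/forallP=> C; apply/implyP=> /imsetP[x _ ->].
rewrite component_cycle_graph.
rewrite is_vertex_circuit ?is_edge_circuit ?is_cycle_circuit ?orbit_uniq //.
by have := in_orbit s x; case: (orbit s x) => [|? [|? []]].
Qed.

(** The kind of a component is determined by its number of vertices, so no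
    component is counted twice. *)
Lemma num_components_card H : modified_elementary H ->
  num_components H = #|components H|.
Proof.
move=> meH; rewrite /num_components /num_cycles /num_edges /num_vertices.
rewrite -addnA -[RHS](cardsID [set C | is_cycle C]).
rewrite -[#|_ :\: _|](cardsID [set C | is_edge C]).
congr (_ + (_ + _)); apply: eq_card => C; rewrite !inE //;
  have [CH|] := boolP (C \in components H); rewrite ?andbF //= ?andbT.
- rewrite andb_idl // => eC.
  by apply/negP => /is_cycle_card; rewrite (is_edge_card eC).
- have [vC|nv] := boolP (is_vertex C).
    symmetry; apply/andP; split; apply/negP;
      [move/is_edge_card | move/is_cycle_card]; by rewrite (is_vertex_card vC).
  have := implyP (forallP meH C) CH; rewrite (negPf nv) /=.
  by case: (is_edge C) => //= ->.
Qed.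

Lemma card_components_cycle_graph s :
  #|components (cycle_graph s)| = #|porbits s|.
Proof.
have CV x : (component (cycle_graph s) x).1 = porbit s x.
  rewrite component_cycle_graph; apply/setP=> y; rewrite inE -fconnect_orbit.
  apply/idP/porbitP => [xy|[i ->]]; last by rewrite permX fconnect_iter.
  by exists (findex s x y); rewrite permX iter_findex.
have <- : [set C.1 | C in components (cycle_graph s)] = porbits s.
  rewrite -imset_comp; apply/setP=> A.
  apply/imsetP/imsetP=> [] [x _ ->]; exists x; rewrite ?inE //; first exact: CV.
  exact/esym/CV.
rewrite [RHS]card_in_imset // => _ _ /imsetP[x _ ->] /imsetP[y _ ->].
rewrite !CV => /eqP; rewrite eq_porbit_mem => /porbitP[i ->].
by symmetry; apply/eqP; rewrite component_cycle_graph_eq permX fconnect_iter.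
Qed.

Lemma odd_perm_cycle_graph s :
  odd_perm s = odd (#|T| - num_components (cycle_graph s)).
Proof.
rewrite num_components_card ?modified_elementary_cycle_graph //.
rewrite oddB; first by rewrite card_components_cycle_graph.
by apply: leq_trans (leq_imset_card _ _) _; rewrite cardsT.
Qed.

Lemma isolated_cycle_graph s : isolated (cycle_graph s) = [set x | s x == x].
Proof.
apply/setP=> x; rewrite !inE /=; apply/forallP/eqP => [/(_ (s x))|sx y].
  by rewrite hadj_cycle_graph negbK => /eqP.
apply/hadj_cycle_graphP=> [[/negP xy [E|E]]]; apply: xy; apply/eqP.
  by rewrite E sx.
by apply: (@perm_inj _ s); rewrite sx.
Qed.

Lemma is_vertex_cycle_graph s x :
  is_vertex (component (cycle_graph s) x) = (s x == x).
Proof.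
rewrite component_cycle_graph is_vertex_circuit ?orbit_uniq //.
apply/eqP/eqP => [o1|sx].
  have := in_orbit s x; have := mem_orbit (in_orbit s x).
  by case: orbit o1 => [|a []] //= _; rewrite !inE => /eqP-> /eqP->.
rewrite -(card_uniqP (orbit_uniq s x)); apply: (@eq_card1 _ x) => y.
rewrite -fconnect_orbit inE; apply/idP/eqP => [/iter_findex <-|->].
  by rewrite iter_fix.
exact: connect0.
Qed.

Lemma num_vertices_cycle_graph s :
  num_vertices (cycle_graph s) = #|isolated (cycle_graph s)|.
Proof.
rewrite isolated_cycle_graph /num_vertices.
have inj : {in [set x | s x == x] &, injective (component (cycle_graph s))}.
  move=> x y; rewrite !inE => /eqP sx _ /eqP.
  by rewrite component_cycle_graph_eq => /iter_findex <-; rewrite iter_fix.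
rewrite -(card_in_imset inj); congr #|pred_of_set _|; apply/setP=> C.
rewrite inE; apply/andP/imsetP=> [[/imsetP[x _ ->]]|[x]].
  by rewrite is_vertex_cycle_graph => sx; exists x; rewrite ?inE.
rewrite inE -is_vertex_cycle_graph => vx ->; split=> //.
exact: imset_f.
Qed.

(** The orbit of [x] has at least three elements exactly when [s (s x) != x].
    Written with the inverse, this says that the two directions of travel
    differ at [x]. *)
Lemma is_cycle_cycle_graph s x :
  is_cycle (component (cycle_graph s) x) = (s x != s^-1%g x).
Proof.
have -> : (s x == s^-1%g x) = (s (s x) == x).
  by rewrite -(inj_eq (@perm_inj _ s)) permKV.
rewrite component_cycle_graph is_cycle_circuit ?orbit_uniq //.
have [s2|s2] := eqVneq (s (s x)) x; apply/idP.
  apply/negP; rewrite -leqNgt; apply: (@uniq_leq_size _ _ [:: x; s x]).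
    exact: orbit_uniq.
  move=> y; rewrite -fconnect_orbit => /iter_findex <-.
  elim: findex => [|n]; rewrite ?inE ?eqxx //=.
  by case/orP=> /eqP->; rewrite ?s2 eqxx ?orbT.
apply: (@uniq_leq_size _ [:: x; s x; s (s x)]) => [|y].
  have sx : s x != x by apply: contraNneq s2 => sx; rewrite !sx.
  rewrite /= !inE negb_or 2![x == _]eq_sym sx s2 /=.
  by rewrite eq_sym (inj_eq (@perm_inj _ s)) sx.
by rewrite !inE => /or3P[]/eqP->; rewrite ?mem_orbit ?in_orbit.
Qed.

(** * The permutations with a given graph *)

(** The neighbours of [x] in [cycle_graph t] are [t x] and its preimage. *)
Lemma cycle_graph_eq_or_inv s t x : cycle_graph s = cycle_graph t ->
  s x = t x \/ s x = t^-1%g x.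
Proof.
move=> E; have [sx|sx] := eqVneq (s x) x.
  left; have: x \in isolated (cycle_graph t).
    by rewrite -E isolated_cycle_graph inE sx.
  by rewrite isolated_cycle_graph inE sx => /eqP.
have: hadj (cycle_graph t) x (s x) by rewrite -E hadj_cycle_graph.
case/hadj_cycle_graphP=> _ [-> | Ex]; [by left | right].
by rewrite [in RHS]Ex permK.
Qed.

(** Each of the two maps [y := s x] to the image or the preimage of [y] under
    the other. Both preimages are [x], so if they disagreed at [y] then both
    would turn back to [x], and thus agree. *)
Lemma same_direction_step s t x : cycle_graph s = cycle_graph t ->
  s x = t x -> s (s x) = t (s x).
Proof.
move=> E sx; set y := s x.
have [//|sy] := cycle_graph_eq_or_inv y E.
have tx : t^-1%g y = x by rewrite /y sx permK.
have [//|ty] := cycle_graph_eq_or_inv y (esym E).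
by rewrite sy tx ty permK.
Qed.

Lemma same_direction_fconnect s t x y : cycle_graph s = cycle_graph t ->
  fconnect t x y -> (s x == t x) = (s y == t y).
Proof.
move=> E xy; wlog suff: x y xy / s x == t x -> s y == t y.
  move=> suf; apply/idP/idP; apply: suf => //.
  by rewrite fconnect_sym //; exact: perm_inj.
move/eqP=> sx; apply/eqP; rewrite -(iter_findex xy).
elim: findex => //= n sz; rewrite -sz; exact: same_direction_step.
Qed.

(** Each component is listed as a circuit, chosen once for the whole component,
    and the permutation moves every vertex to the next one in its list. *)
Lemma ex_cycle_graph H : spanning H -> modified_elementary H ->
  (forall e, e \in eset H -> exists x y, e = [set x; y]) ->
  exists s, cycle_graph s = H.
Proof.
move=> /eqP spH meH edgH.
have [f fP] : exists f : {set T} * {set {set T}} -> seq T,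
    forall C, C \in components H -> uniq (f C) /\ C = circuit (f C).
  apply: (fin_all_exists (P := fun C q =>
    C \in components H -> uniq q /\ C = circuit q)) => C.
  have [CH|] := boolP (C \in components H); last by exists [::].
  have [q Uq ->] := elementary_circuit (implyP (forallP meH C) CH).
  by exists q.
pose q x := f (component H x).
have compH x : component H x \in components H.
  by apply: imset_f; rewrite spH inE.
have Uq x : uniq (q x) by have [] := fP _ (compH x).
have qE x : component H x = circuit (q x) by have [] := fP _ (compH x).
have mem_q x y : (y \in q x) = connect (hadj H) x y.
  have := congr1 (fun C : {set T} * {set {set T}} => y \in C.1) (qE x).
  by rewrite /= !inE spH inE.
have eq_q x y : y \in q x -> q y = q x.
  by rewrite mem_q => /component_connect E; rewrite /q E.
have q_id x : x \in q x by rewrite mem_q connect0.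
pose g x := next (q x) x.
have gK : cancel g (fun x => prev (q x) x).
  move=> x; rewrite /= (eq_q x) ?prev_next // /g ?mem_next ?q_id //.
exists (perm (can_inj gK)).
rewrite [H in RHS]surjective_pairing -[H.1]/(vset H) spH.
congr pair; apply/setP=> e; apply/imsetP/idP=> [[x]|eH].
  rewrite inE !permE /= => gx ->.
  suff: [set x; g x] \in (component H x).2 by rewrite inE => /andP[].
  by rewrite qE; apply/imsetP; exists x; rewrite // inE q_id.
have [x [y exy]] := edgH e eH.
have: e \in (component H x).2.
  rewrite inE eH /= exy; apply/subsetP=> z; rewrite !inE spH inE /=.
  by case/orP=> /eqP->; rewrite ?connect0 // connect1 // /hadj -exy.
rewrite qE => /imsetP[z]; rewrite inE => /andP[zq gz] ->.
by exists z; rewrite ?inE permE /= /g (eq_q _ _ zq).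
Qed.

Definition reorient s (A : {set {set T} * {set {set T}}}) x :=
  if component (cycle_graph s) x \in A then s x else s^-1%g x.

Lemma component_perm s x :
  component (cycle_graph s) (s x) = component (cycle_graph s) x.
Proof. by apply/esym/eqP; rewrite component_cycle_graph_eq fconnect1. Qed.

Lemma component_permV s x :
  component (cycle_graph s) (s^-1%g x) = component (cycle_graph s) x.
Proof. by rewrite -[LHS]component_perm permKV. Qed.

Lemma reorientK s A :
  cancel (reorient s A) (fun x =>
    if component (cycle_graph s) x \in A then s^-1%g x else s x).
Proof.
move=> x /=; rewrite /reorient; case xA: (component (cycle_graph s) x \in A).
  by rewrite component_perm xA permK.
by rewrite component_permV xA permKV.
Qed.

Definition reorient_perm s A : {perm T} := perm (can_inj (reorientK s A)).

Lemma cycle_graph_reorient s A :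
  cycle_graph (reorient_perm s A) = cycle_graph s.
Proof.
congr pair; apply/setP=> e; apply/imsetP/imsetP=> [] [x]; rewrite inE /=.
  rewrite permE /reorient; case: ifP => xA sx ->.
    by exists x; rewrite ?inE.
  exists (s^-1%g x); rewrite ?permKV 1?setUC // inE /= permKV.
  by rewrite eq_sym.
move=> sx ->; case xA: (component (cycle_graph s) x \in A).
  by exists x; rewrite ?inE permE /reorient xA.
exists (s x); rewrite ?inE permE /reorient component_perm xA permK 1?setUC //.
by rewrite eq_sym.
Qed.

(** The permutations with the same graph as [s] are the [reorient_perm s A],
    with [A] ranging over the sets of cycle components: reversing a vertex or an
    edge has no effect, while reversing a cycle does. *)
Lemma card_cycle_graph_fiber s :
  #|[set t | cycle_graph t == cycle_graph s]| = 2 ^ num_cycles (cycle_graph s).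
Proof.
rewrite /num_cycles -card_powerset.
set K := [set C in _ | _].
rewrite -(@card_in_imset _ _ (reorient_perm s) (mem (powerset K))).
  congr #|pred_of_set _|; apply/setP=> t; rewrite inE.
  apply/eqP/imsetP=> [E|[A _ ->]]; last exact: cycle_graph_reorient.
  (* One common step suffices for [t] and [s] to agree on a whole cycle. *)
  exists [set C in K | [exists x,
      (C == component (cycle_graph s) x) && (t x == s x)]].
    by rewrite inE; apply/subsetP => C; rewrite inE => /andP[].
  apply/permP => x; rewrite permE /reorient inE.
  case: ifP => [/andP[_ /existsP[y /andP[/eqP/eqP xy ty]]]|].
    rewrite component_cycle_graph_eq in xy.
    by apply/eqP; rewrite (same_direction_fconnect E xy).
  (* If nevertheless [t x = s x], then the component of [x] is not a cycle, and
     the image and the preimage of [x] under [s] coincide. *)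
  case: (cycle_graph_eq_or_inv x E) => // tx /negbT; rewrite negb_and.
  have xC : component (cycle_graph s) x \in components (cycle_graph s).
    exact: imset_f.
  rewrite inE xC is_cycle_cycle_graph tx /= negbK => /orP[/eqP//|].
  by case/existsP; exists x; rewrite tx !eqxx.
move=> A B AK BK E; apply/setP=> C.
have [|CK] := boolP (C \in K); last first.
  have out D : D \in powerset K -> (C \in D) = false.
    by rewrite powersetE => /subsetP DK; apply: contraNF CK; exact: DK.
  by rewrite !out.
rewrite inE => /andP[/imsetP[x _ ->]].
rewrite is_cycle_cycle_graph => /negPf ne.
have /permP/(_ x) := E; rewrite !permE /reorient.
by do 2 case: ifP => // _; move/eqP; rewrite ?ne ?[s^-1%g x == _]eq_sym ?ne.
Qed.

End CycleGraph.

Local Open Scope ring_scope.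

Lemma card_cycle_graph_preim (T : finType) (G : sgraph T) H :
  spanning_modified_elementary G H ->
  #|[set s | cycle_graph s == H]| = (2 ^ num_cycles H)%N.
Proof.
case/and3P=> /andP[/subsetP sub _] spH meH.
have [|s <-] := ex_cycle_graph spH meH; last exact: card_cycle_graph_fiber.
move=> e /sub; rewrite inE => /existsP[x /existsP[y /andP[_ /eqP ->]]].
by exists x, y.
Qed.

Lemma cycle_graph_spanningP (T : finType) (G : sgraph T) (s : {perm T}) :
  reflect (forall x, s x != x -> adj G x (s x))
    (spanning_modified_elementary G (cycle_graph s)).
Proof.
rewrite /spanning_modified_elementary modified_elementary_cycle_graph.
rewrite /spanning eqxx !andbT.
apply: (iffP andP) => [[/subsetP sub _] x sx|adjs].
  by rewrite -mem_edges sub //; apply/imsetP; exists x; rewrite ?inE.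
split; last by apply/forallP=> e; apply/implyP => _; apply: subsetT.
by apply/subsetP=> e /imsetP[x]; rewrite inE => sx ->; rewrite mem_edges adjs.
Qed.

(** * The Leibniz expansion *)

Section Weights.
Variables (R : comPzRingType) (n : nat) (G : sgraph 'I_n) (alpha : R).

Lemma B_mxE i j : B_mx alpha G i j =
  if j == i then (1 - alpha) * (deg G i)%:R
  else (2 * alpha - 1) * (adj G i j)%:R.
Proof.
rewrite !mxE eq_sym; case: eqVneq => [->|_].
  by rewrite adj_irr mulr1n subr0 mulr0 add0r.
by rewrite mulr0n sub0r mulrN -mulrBl opprB addrA -mulr2n mulr_natl.
Qed.

Lemma prod_B_mx (s : 'S_n) :
  \prod_i B_mx alpha G i (s i) =
  if spanning_modified_elementary G (cycle_graph s) then
  (1 - alpha) ^+ num_vertices (cycle_graph s)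
    * (2 * alpha - 1) ^+ (n - num_vertices (cycle_graph s))%N
    * \prod_(v in isolated (cycle_graph s)) (deg G v)%:R else 0.
Proof.
case: (cycle_graph_spanningP G s) => [adjs|nadj]; last first.
  have [/forallP adjs|] := boolP [forall x, (s x != x) ==> adj G x (s x)].
    by case: nadj => x; apply/implyP.
  rewrite negb_forall => /existsP[x]; rewrite negb_imply => /andP[sx nadjx].
  by rewrite (bigD1 x) //= B_mxE (negPf sx) (negPf nadjx) mulr0 mul0r.
rewrite num_vertices_cycle_graph isolated_cycle_graph; set F := [set x | _].
rewrite (bigID (mem F)) /= mulrAC -prodr_const -big_split /=; congr (_ * _).
  by apply: eq_bigr => i; rewrite inE B_mxE => ->.
have -> : (n - #|F|)%N = #|~: F| by rewrite [RHS]cardsCs setCK card_ord.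
rewrite -prodr_const; apply: eq_big => [i|i]; rewrite !inE // => si.
by rewrite B_mxE (negPf si) adjs // mulr1.
Qed.

End Weights.

Theorem theorem5p1 (R : realFieldType) (n : nat) (G : sgraph 'I_n) (alpha : R)
  (alpha_gt0 : 0 < alpha) (alpha_le1 : alpha <= 1) :
  \det (B_mx alpha G) =
  \sum_(H : {set 'I_n} * {set {set 'I_n}} | spanning_modified_elementary G H)
    (-1) ^+ (n - num_components H)%N * 2 ^+ num_cycles H
    * (1 - alpha) ^+ num_vertices H
    * (2 * alpha - 1) ^+ (n - num_vertices H)%N
    * \prod_(v in isolated H) (deg G v)%:R.
Proof.
rewrite /determinant.
rewrite (bigID (fun s : 'S_n =>
  spanning_modified_elementary G (cycle_graph s))) /=.
rewrite [X in _ + X]big1 ?addr0 => [|s /negPf nsme]; last first.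
  by rewrite prod_B_mx nsme mulr0.
rewrite (partition_big (@cycle_graph _) (spanning_modified_elementary G)) //=.
apply: eq_bigr => H smeH.
transitivity (\sum_(s in [set s : 'S_n | cycle_graph s == H])
   ((-1) ^+ (n - num_components H)%N * ((1 - alpha) ^+ num_vertices H
    * (2 * alpha - 1) ^+ (n - num_vertices H)%N
    * \prod_(v in isolated H) (deg G v)%:R))).
  apply: eq_big => s.
    by rewrite inE; case: eqP => [->|]; rewrite ?andbT ?andbF.
  case/andP=> sme /eqP <-; rewrite prod_B_mx sme odd_perm_cycle_graph signr_odd.
  by rewrite card_ord.
rewrite sumr_const (card_cycle_graph_preim smeH) -[LHS]mulr_natr natrX.
by rewrite -!mulrA [X in _ = _ * X]mulrC -!mulrA.
Qed.
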